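(* Let $X=(V,E)$ be a finite, simple, connected graph that is regular and bipartite, and suppose that its graph Laplacian $L$ has exactly four distinct eigenvalues. Then $X$ satisfies the monotonic normalized heat diffusion property (MNHD): for all distinct vertices $u,v\in V$, the function $$t\longmapsto r_t(u,v)=\frac{H_t(u,v)}{H_t(u,u)},\qquad t\ge 0,$$ is monotonically non-decreasing on $[0,\infty)$, where $H_t=e^{-tL}$ is the heat kernel of $X$.
   Context: For a finite simple graph $X=(V,E)$ the graph Laplacian is the symmetric matrix $L=D-A$ indexed by $V\times V$, where $D$ is the diagonal matrix of vertex degrees and $A$ is the adjacency matrix. The heat kernel is the matrix exponential $H_t=e^{-tL}$, $t\ge 0$, with entries $H_t(u,v)$, $u,v\in V$. ''Four distinct Laplacian eigenvalues'' means that the set $\sigma(L)$ of distinct eigenvalues of $L$ has exactly four elements (including $0$). *)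

(* Defs.v *)
From mathcomp Require Import all_boot all_order all_algebra.
From mathcomp Require Import all_classical all_reals all_analysis.

Set Implicit Arguments.
Unset Strict Implicit.
Unset Printing Implicit Defensive.

Import Order.TTheory GRing.Theory Num.Theory.
Import numFieldNormedType.Exports.

Local Open Scope classical_set_scope.
Local Open Scope ring_scope.

Section Graphs.
Variables (V : finType) (e : rel V).

Definition simple_graph : Prop := symmetric e /\ irreflexive e.

Definition connected_graph : Prop := forall u v : V, connect e u v.

Definition degree (v : V) : nat := #|[set w | e v w]%SET|.

Definition regular_graph : Prop := exists d : nat, forall v : V, degree v = d.

Definition bipartite_graph : Prop :=
  exists A : {set V}, forall u v : V, e u v -> (u \in A) != (v \in A).

End Graphs.

(* The sum of the exponential series, in the topology of 'M[R]_n. *)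
Definition mxexp (R : realType) (n : nat) (A : 'M[R]_n) : 'M[R]_n :=
  limn (series (fun k : nat => (k`!%:R)^-1 *: A ^+ k)).

Definition spectrum (R : realType) (n : nat) (A : 'M[R]_n) : set R :=
  [set a | eigenvalue A a].

Section HeatKernel.
Variables (R : realType) (V : finType) (e : rel V).

(* MathComp matrices are indexed by ordinals: V x V matrices are represented
   in 'M_#|V| through the bijection enum_val : 'I_#|V| -> V, with inverse
   enum_rank. *)
Definition adjacency : 'M[R]_#|V| :=
  \matrix_(i, j) (e (enum_val i) (enum_val j))%:R.

Definition degree_mx : 'M[R]_#|V| :=
  diag_mx (\row_i (degree e (enum_val i))%:R).

Definition laplacian : 'M[R]_#|V| := degree_mx - adjacency.

Definition heat_kernel (t : R) (u v : V) : R :=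
  mxexp (- t *: laplacian) (enum_rank u) (enum_rank v).

Definition heat_ratio (u v : V) (t : R) : R :=
  heat_kernel t u v / heat_kernel t u u.

Definition MNHD : Prop :=
  forall u v : V, u != v ->
    {in `[0, +oo[ &, {homo heat_ratio u v : s t / s <= t}}.

End HeatKernel.

(* Main.v *)
Require Import Defs.
From mathcomp Require Import all_boot all_order all_algebra.
From mathcomp Require Import all_classical all_reals all_analysis.
From mathcomp Require Import complex finmap ring lra.

Set Implicit Arguments.
Unset Strict Implicit.
Unset Printing Implicit Defensive.

Import Order.TTheory GRing.Theory Num.Theory.
Import numFieldNormedType.Exports.

Local Open Scope classical_set_scope.
Local Open Scope ring_scope.

(* The spectrum of the adjacency matrix A of a d-regular bipartite graph is
   symmetric about 0, so four Laplacian eigenvalues mean that A has spectrum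
   {d, -d, a, -a} and (A^2 - d^2)(A^2 - a^2) = 0.  By connectedness the columns
   of A^2 - a^2 are constant on each part, hence A^2 = a^2 + (d - a^2) K with K
   the indicator of lying in the same part: the graph is the incidence graph of
   a symmetric design, with parts of size n and (n - 1) a^2 = d (n - d).
   The heat kernel is then explicit.  Up to the common factor exp(-dt) / n it is
   (n - 1) cosh at + cosh dt on the diagonal, cosh dt - cosh at inside a part,
   and, across the parts, sinh dt + ((n - d) / a) sinh at for adjacent vertices
   and sinh dt - (d / a) sinh at for non-adjacent ones.  In each case the
   Wronskian of the numerator and the denominator is nonnegative. *)

(** * Matrix exponential and spectral annihilation *)

(** Applying [A ^+ k] to the resolution of the identity replaces [A] by [l i] on each [E i], so the
    matrix series is a finite combination of scalar exponential series. *)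
Lemma mxexp_eigen_decomposition (R : realType) (n : nat) (I : finType)
    (A : 'M[R]_n) (E : I -> 'M[R]_n) (l : I -> R) :
  \sum_i E i = 1%:M -> (forall i, A *m E i = l i *: E i) ->
  mxexp A = \sum_i expR (l i) *: E i.
Proof.
move=> sumE AE.
have powA k : A ^+ k = \sum_i l i ^+ k *: E i.
  elim: k => [|k IH].
    by rewrite expr0 -[1]sumE; apply: eq_bigr => i _; rewrite expr0 scale1r.
  rewrite exprS IH.
  change (A *m (\sum_i l i ^+ k *: E i) = \sum_i l i ^+ k.+1 *: E i).
  rewrite mulmx_sumr; apply: eq_bigr => i _.
  by rewrite -scalemxAr AE scalerA -exprSr.
apply: cvg_lim; first exact: norm_hausdorff.
have -> : series (fun k : nat => (k`!%:R)^-1 *: A ^+ k) =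
    (fun m => \sum_i series (exp_coeff (l i)) m *: E i).
  apply/funext => m; rewrite /series /=.
  rewrite (eq_bigr (fun k => \sum_i (exp_coeff (l i) k) *: E i)); last first.
    move=> k _; rewrite powA scaler_sumr; apply: eq_bigr => i _.
    by rewrite scalerA mulrC.
  by rewrite exchange_big; apply: eq_bigr => i _; rewrite scaler_suml.
apply: cvg_big => [|i _]; first exact: add_continuous.
apply: cvgZr_tmp; exact: is_cvg_series_exp_coeff.
Qed.

(* Over R[i] the real symmetric matrix is unitarily diagonalizable with real
   diagonal, and each diagonal entry is an eigenvalue over R. *)
Lemma symmetric_mx_annihilator (R : rcfType) (n : nat) (A : 'M[R]_n)
    (s : seq R) :
  A^T = A -> (forall a, eigenvalue A a -> a \in s) ->
  \big[mulmx/1%:M]_(a <- s) (A - a%:M) = 0.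
Proof.
move=> symA specA.
pose A' := map_mx (real_complex R) A.
have hermA' : A' \is hermsymmx.
  apply: realsym_hermsym.
    by apply/is_hermitianmxP; rewrite expr0 scale1r map_mx_id // map_trmx symA.
  by apply/mxOverP => i j; rewrite mxE; apply/complex_realP; exists (A i j).
have real_diag := hermitian_spectral_diag_real hermA'.
have /hermitian_normalmx/orthomx_spectralP := hermA'.
have := spectral_unit A'.
set P := spectralmx A'; set D := spectral_diag A' => uP defA'.
have D_in j : exists2 a, a \in s & D 0 j = real_complex R a.
  have /mxOverP/(_ 0 j)/complex_realP [a Da] := real_diag.
  exists a => //; apply: specA.
  (* Since [A'] is [invmx P *m diag_mx D *m P], row [j] of the invertible [P] is a left eigenvector
     for [D 0 j]; a real eigenvalue of [A'] descends to [A]. *)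
  suff: eigenvalue A' (D 0 j) by rewrite Da (eigenvalue_map (real_complex R)).
  apply/eigenvalueP; exists (row j P).
    rewrite -row_mul -/A' defA' !mulmxA mulmxV // mul1mx.
    by apply/rowP => k; rewrite mul_diag_mx !mxE.
  apply/eqP => /(congr1 (mulmx^~ (invmx P))).
  rewrite mul0mx -row_mul mulmxV // => /rowP/(_ j)/eqP.
  by rewrite !mxE eqxx oner_eq0.
apply/eqP; rewrite -(map_mx_eq0 (real_complex R)); apply/eqP.
(* Conjugation makes the product diagonal; by [D_in] each diagonal entry then has a vanishing
   factor. *)
have -> : map_mx (real_complex R) (\big[mulmx/1%:M]_(a <- s) (A - a%:M)) =
    invmx P *m diag_mx (\row_j \prod_(a <- s) (D 0 j - real_complex R a)) *m P.
  elim: {specA D_in} s => [|a s IH].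
    rewrite !big_nil map_mx1 (_ : \row_j _ = const_mx 1).
      by rewrite diag_const_mx mulmx1 mulVmx.
    by apply/rowP => j; rewrite !mxE big_nil.
  rewrite !big_cons map_mxM IH map_mxB map_scalar_mx -/A' /=.
  have -> : A' - (real_complex R a)%:M =
      invmx P *m diag_mx (\row_j (D 0 j - real_complex R a)) *m P.
    have -> c : c%:M = invmx P *m c%:M *m P.
      by rewrite scalar_mxC -mulmxA mulVmx // mulmx1.
    rewrite {1}defA' -mulmxBl -mulmxBr; congr (_ *m _ *m _).
    by apply/matrixP => i j; rewrite !mxE -mulrnBl.
  rewrite -!mulmxA (mulmxA P) mulmxV // mul1mx !mulmxA.
  congr (_ *m _); rewrite -mulmxA; congr (_ *m _).
  rewrite mulmx_diag; congr diag_mx.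
  by apply/rowP => j; rewrite !mxE big_cons.
rewrite (_ : \row_j _ = 0) ?diag_mx0 ?mulmx0 ?mul0mx //.
  by rewrite raddf0 mulmx0 mul0mx.
apply/rowP => j; rewrite !mxE.
have [a a_s ->] := D_in j.
by apply/eqP; rewrite prodf_seq_eq0; apply/hasP; exists a => //=; rewrite subrr.
Qed.

(** * Monotone quotients and hyperbolic functions *)

(** The derivative of the quotient is the Wronskian over [g ^+ 2]; the mean value theorem
    concludes. *)
Lemma ratio_nondecreasing (R : realType) (f g df dg : R -> R) :
  (forall t : R, is_derive t 1 f (df t)) ->
  (forall t : R, is_derive t 1 g (dg t)) ->
  (forall t : R, 0 < g t) ->
  (forall t : R, 0 <= t -> 0 <= df t * g t - f t * dg t) ->
  {in `[0, +oo[ &, {homo (fun t => f t / g t) : s t / s <= t}}.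
Proof.
move=> fD gD g0 W s t + _; rewrite in_itv /= andbT => s0 st.
pose h' (x : R) := (df x * g x - f x * dg x) / (g x) ^+ 2.
have hD (x : R) : is_derive x 1 (fun t => f t / g t) (h' x).
  have gx : g x != 0 by rewrite gt_eqF.
  have ? := fD x; have ? := gD x.
  apply: is_derive_eq.
  rewrite /h' /GRing.scale /=; field; exact: gx.
have [||c] := @MVT_segment R (fun t => f t / g t) h' s t => //.
  apply: continuous_subspaceT => x.
  by apply/differentiable_continuous/derivable1_diffP; case: (hD x).
rewrite in_itv /= => /andP[sc _] E.
rewrite -subr_ge0 E mulr_ge0 ?subr_ge0 // divr_ge0 ?sqr_ge0 //.
by apply: W; lra.
Qed.

Definition coshR (R : realType) (x : R) : R := (expR x + expR (- x)) / 2.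
Definition sinhR (R : realType) (x : R) : R := (expR x - expR (- x)) / 2.

Section Hyperbolic.
Variable R : realType.
Implicit Types x y a t : R.

Lemma is_derive_coshR a t :
  is_derive t 1 (fun t => coshR (a * t)) (a * sinhR (a * t)).
Proof.
rewrite /coshR /sinhR; apply: is_derive_eq.
rewrite /GRing.scale /=; ring.
Qed.

Lemma is_derive_sinhR a t :
  is_derive t 1 (fun t => sinhR (a * t)) (a * coshR (a * t)).
Proof.
rewrite /coshR /sinhR; apply: is_derive_eq.
rewrite /GRing.scale /=; ring.
Qed.

Lemma coshR_gt0 x : 0 < coshR x.
Proof. by rewrite divr_gt0 // addr_gt0 // expR_gt0. Qed.

Lemma sinhR_ge0 x : 0 <= x -> 0 <= sinhR x.
Proof. by move=> x0; rewrite divr_ge0 // subr_ge0 ler_expR; lra. Qed.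

Lemma coshR2B_sinhR2 x : coshR x ^+ 2 - sinhR x ^+ 2 = 1.
Proof. by rewrite -(expRxMexpNx_1 x) /coshR /sinhR; field. Qed.

Lemma sinhRB x y : sinhR (x - y) = sinhR x * coshR y - coshR x * sinhR y.
Proof. by rewrite /coshR /sinhR opprB !expRD; field. Qed.

Lemma coshRB x y : coshR (x - y) = coshR x * coshR y - sinhR x * sinhR y.
Proof. by rewrite /coshR /sinhR opprB !expRD; field. Qed.

Lemma coshR_ge1 x : 1 <= coshR x.
Proof.
have := coshR2B_sinhR2 x; have := coshR_gt0 x; have := sqr_ge0 (sinhR x).
set c := coshR x; set s := sinhR x; nra.
Qed.

End Hyperbolic.

(** * Monotonicity of the three explicit heat ratios *)

Section HeatRatios.
Variables (R : realType) (n d a : R).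
Hypotheses (a_gt0 : 0 < a) (n_ge1 : 1 <= n) (d_ge1 : 1 <= d) (d_le_n : d <= n).
Hypothesis design : (n - 1) * a ^+ 2 = d * (n - d).

Let d_gt0 : 0 < d. Proof. exact: lt_le_trans ltr01 d_ge1. Qed.

Let den t := (n - 1) * coshR (a * t) + coshR (d * t).
Let dden t := (n - 1) * (a * sinhR (a * t)) + d * sinhR (d * t).

Let den_gt0 t : 0 < den t.
Proof. by rewrite ltr_wpDl ?coshR_gt0 // mulr_ge0 ?(ltW (coshR_gt0 _)) // subr_ge0. Qed.

Let is_derive_den (t : R) : is_derive t 1 den (dden t).
Proof.
have ? := is_derive_coshR a t; have ? := is_derive_coshR d t.
by apply: is_derive_eq; rewrite /dden /GRing.scale /=; ring.
Qed.

Lemma same_part_ratio_nondecreasing :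
  a <= d ->
  {in `[0, +oo[ &, {homo (fun t => (coshR (d * t) - coshR (a * t)) / den t)
    : s t / s <= t}}.
Proof.
move: n_ge1 => n1 le_ad.
apply: (@ratio_nondecreasing _ _ _
  (fun t => d * sinhR (d * t) - a * sinhR (a * t)) dden) => // t.
  have ? := is_derive_coshR a t; have ? := is_derive_coshR d t.
  by apply: is_derive_eq; rewrite /GRing.scale /=; ring.
move=> t0; rewrite /den /dden.
have s0 : 0 <= sinhR (d * t) by rewrite sinhR_ge0 // mulr_ge0 // ltW.
have c0 := coshR_gt0 (a * t).
have : 0 <= sinhR (d * t - a * t).
  by apply: sinhR_ge0; rewrite -mulrBl mulr_ge0 // subr_ge0.
rewrite sinhRB.
move: (coshR (d * t)) (sinhR (d * t)) (coshR (a * t)) (sinhR (a * t)) s0 c0.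
move=> C S c s S0 c0 h.
(* The Wronskian is [n * (d * S * c - a * C * s)], regrouped so that [h], i.e. sinh((d - a)t) >= 0,
   applies. *)
rewrite (_ : _ - _ = n * (a * (S * c - C * s) + (d - a) * (S * c))); last by ring.
apply: mulr_ge0; first lra.
apply: addr_ge0; first by rewrite mulr_ge0 // ltW.
by rewrite !mulr_ge0 ?subr_ge0 // ltW.
Qed.

Lemma adjacent_ratio_nondecreasing :
  {in `[0, +oo[ &,
    {homo (fun t => (sinhR (d * t) + (n - d) / a * sinhR (a * t)) / den t)
    : s t / s <= t}}.
Proof.
move: a_gt0 n_ge1 d_ge1 d_le_n => a0 n1 d1 dn.
apply: (@ratio_nondecreasing _ _ _
  (fun t => d * coshR (d * t) + (n - d) * coshR (a * t)) dden) => // t.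
  have ? := is_derive_sinhR a t; have ? := is_derive_sinhR d t.
  apply: is_derive_eq; rewrite /GRing.scale /=; field; lra.
move=> t0; rewrite /den /dden.
have S0 : 0 <= sinhR (d * t) by rewrite sinhR_ge0 // mulr_ge0 // ltW.
have s0 : 0 <= sinhR (a * t) by rewrite sinhR_ge0 // mulr_ge0 // ltW.
have := coshR_ge1 (d * t - a * t).
rewrite coshRB.
have := coshR2B_sinhR2 (d * t); have := coshR2B_sinhR2 (a * t).
move: (coshR (d * t)) (sinhR (d * t)) (coshR (a * t)) (sinhR (a * t)) S0 s0.
move=> C S c s S0 s0 cs CS h.
(* By [design] the two contributions to the coefficient of [S * s] are equal, so it becomes
   [2 * ((n - 1) * a)]. *)
have nda : (n - d) / a = (n - 1) * a / d.
  apply/eqP; rewrite eqr_div ?lt0r_neq0 //.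
  by rewrite mulrC -design expr2 mulrA.
rewrite (_ : _ - _ = (n - d) * (n - 1) * (c ^+ 2 - s ^+ 2) +
    d * (C ^+ 2 - S ^+ 2) + ((n - d) + d * (n - 1)) * (C * c)
    - ((n - d) / a * d + (n - 1) * a) * (S * s)); last by field; lra.
rewrite cs CS nda !mulr1 divfK ?lt0r_neq0 //.
(* the arithmetic-geometric mean inequality for d (n - 1) and n - d *)
have amgm : 2 * ((n - 1) * a) <= (n - d) + d * (n - 1).
  rewrite -(ler_pM2l d_gt0) mulrDr -design.
  have : 0 <= (n - 1) * (d - a) ^+ 2 by rewrite mulr_ge0 ?sqr_ge0 // subr_ge0.
  by rewrite sqrrB; lra.
have Ss0 : 0 <= S * s by apply: mulr_ge0.
have : 0 <= (n - d) * (n - 1) by apply: mulr_ge0; lra.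
have na0 : 0 <= (n - 1) * a by apply: mulr_ge0; lra.
move: na0 amgm; set x := (n - 1) * a; set y := n - d + d * (n - 1) => x0 xy z0.
have : 2 * x * (S * s) <= y * (C * c).
  by apply: ler_pM => //; [lra | lra].
lra.
Qed.

Lemma nonadjacent_ratio_nondecreasing :
  d + 1 <= n ->
  {in `[0, +oo[ &,
    {homo (fun t => (sinhR (d * t) - d / a * sinhR (a * t)) / den t)
    : s t / s <= t}}.
Proof.
move: a_gt0 n_ge1 d_ge1 d_le_n => a0 n1 d1 dn lt_dn.
apply: (@ratio_nondecreasing _ _ _
  (fun t => d * coshR (d * t) - d * coshR (a * t)) dden) => // t.
  have ? := is_derive_sinhR a t; have ? := is_derive_sinhR d t.
  apply: is_derive_eq; rewrite /GRing.scale /=; field; lra.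
move=> t0; rewrite /den /dden.
have S0 : 0 <= sinhR (d * t) by rewrite sinhR_ge0 // mulr_ge0 // ltW.
have s0 : 0 <= sinhR (a * t) by rewrite sinhR_ge0 // mulr_ge0 // ltW.
have := coshR_ge1 (d * t - a * t).
rewrite coshRB.
have := coshR2B_sinhR2 (d * t); have := coshR2B_sinhR2 (a * t).
move: (coshR (d * t)) (sinhR (d * t)) (coshR (a * t)) (sinhR (a * t)) S0 s0.
move=> C S c s S0 s0 cs CS h.
have Ss0 : 0 <= S * s by apply: mulr_ge0.
rewrite (_ : _ - _ = d * (C ^+ 2 - S ^+ 2) - d * (n - 1) * (c ^+ 2 - s ^+ 2) +
    d * (n - 2) * (C * c) + (d ^+ 2 - (n - 1) * a ^+ 2) / a * (S * s));
  last by field; lra.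
rewrite cs CS design.
(* It suffices that the coefficient of [S * s] is at least [- (n - 2)]: then [h], i.e. cosh((d -
   a)t) >= 1, applies. As [1 <= d], this follows from [1 <= a]. *)
rewrite (_ : _ + _ = d * ((n - 2) * (C * c - 1) + (2 * d - n) / a * (S * s)));
  last by field; lra.
apply: mulr_ge0; first lra.
have a_ge1 : 1 <= a.
  have : (n - 1) * 1 <= (n - 1) * a ^+ 2.
    rewrite design.
    (* This product is [d * (n - d) - (n - 1)]. *)
    have : 0 <= (d - 1) * (n - d - 1) by apply: mulr_ge0; lra.
    lra.
  have n1_gt0 : 0 < n - 1 by lra.
  by rewrite ler_pM2l // expr_ge1 // ltW.
have ge_coef : - (n - 2) <= (2 * d - n) / a.
  rewrite ler_pdivlMr //.
  have : 0 <= (n - 2) * (a - 1) by apply: mulr_ge0; lra.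
  lra.
have : - (n - 2) * (S * s) <= (2 * d - n) / a * (S * s) by exact: ler_wpM2r.
have : 0 <= (n - 2) * (C * c - 1 - S * s) by apply: mulr_ge0; lra.
lra.
Qed.

End HeatRatios.

(** * Adjacency matrices of regular bipartite graphs *)

Section RegularBipartite.
Variables (R : realType) (N : nat) (A : 'M[R]_N) (p : 'I_N -> bool) (d : R).
Hypothesis symA : forall i j, A i j = A j i.
Hypothesis bipA : forall i j, p i = p j -> A i j = 0.
Hypothesis idemA : forall i j, A i j * A i j = A i j.
Hypothesis regA : forall i, \sum_j A i j = d.

Definition same_part_mx : 'M[R]_N := \matrix_(i, j) (p i == p j)%:R.
Definition cross_part_mx : 'M[R]_N := \matrix_(i, j) (p i != p j)%:R.
Local Notation K := same_part_mx.
Local Notation K' := cross_part_mx.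

Lemma mul_adj_same : A *m K = d *: K'.
Proof.
apply/matrixP => i j; rewrite !mxE -(regA i) mulr_suml.
apply: eq_bigr => k _; rewrite mxE.
have [/bipA -> | ] := eqVneq (p i) (p k); first by rewrite !mul0r.
by case: (p i) (p j) (p k) => [] [] [].
Qed.

Lemma mul_adj_cross : A *m K' = d *: K.
Proof.
apply/matrixP => i j; rewrite !mxE -(regA i) mulr_suml.
apply: eq_bigr => k _; rewrite mxE.
have [/bipA -> | ] := eqVneq (p i) (p k); first by rewrite !mul0r.
by case: (p i) (p j) (p k) => [] [] [].
Qed.

(** Every edge crosses the parts, so changing the sign of an eigenvector on one part negates its
    eigenvalue. *)
Lemma eigenvalue_opp x : eigenvalue A x -> eigenvalue A (- x).
Proof.
move=> /eigenvalueP [v vA v0]; apply/eigenvalueP.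
exists (\row_i ((-1) ^+ p i * v 0 i)).
  apply/rowP => j; rewrite !mxE.
  have /rowP/(_ j) := vA; rewrite !mxE => e.
  rewrite mulrCA mulNr -e mulrN mulr_sumr -sumrN; apply: eq_bigr => i _.
  rewrite mxE; have [/bipA -> | ] := eqVneq (p i) (p j); first by rewrite !mulr0 oppr0.
  by case: (p i) (p j) => [] [] //= _; rewrite ?expr0 ?expr1 ?mulN1r ?mul1r ?mulNr ?opprK.
apply: contra v0 => /eqP/rowP w0; apply/eqP/rowP => i.
have /eqP := w0 i; rewrite !mxE mulf_eq0 signr_eq0 /=; exact: eqP.
Qed.

Lemma eigenvalue_degree : (0 < N)%N -> eigenvalue A d.
Proof.
move=> N0; apply/eigenvalueP; exists (const_mx 1).
  apply/rowP => j; rewrite !mxE mulr1 -(regA j); apply: eq_bigr => i _.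
  by rewrite mxE mul1r symA.
apply/eqP => /rowP/(_ (Ordinal N0))/eqP; by rewrite !mxE oner_eq0.
Qed.

(** The form in which connectedness enters: the eigenvalue [d] is simple. *)
Hypothesis harmonic_constant : forall x : 'I_N -> R,
  (forall i, \sum_j A i j * x j = d * x i) -> forall i j, x i = x j.
Hypothesis d_neq0 : d != 0.

(* 2 d x is the sum of (A + d) x, a d-eigenvector, hence constant, and of
   (d - A) x, a (-d)-eigenvector, hence constant up to the sign of the part. *)
Lemma square_eigenvector_part_constant (x : 'I_N -> R) :
  (forall i, \sum_j A i j * (\sum_k A j k * x k) = d ^+ 2 * x i) ->
  forall i j, p i = p j -> x i = x j.
Proof.
move=> AAx i j pij.
pose Ax i := \sum_k A i k * x k.
have y_cst : Ax i + d * x i = Ax j + d * x j.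
  apply: (harmonic_constant (x := fun i => Ax i + d * x i)) => k.
  under eq_bigr do rewrite mulrDr mulrCA.
  by rewrite big_split /= -mulr_sumr AAx -/(Ax k); ring.
have : (-1) ^+ p i * (d * x i - Ax i) = (-1) ^+ p j * (d * x j - Ax j).
  apply: (harmonic_constant (x := fun i => (-1) ^+ p i * (d * x i - Ax i))) => k.
  rewrite (eq_bigr (fun l => (-1) ^+ p k * (A k l * Ax l - d * (A k l * x l)))).
    by rewrite -mulr_sumr sumrB -mulr_sumr AAx -/(Ax k); ring.
  move=> l _; have [/bipA -> | ] := eqVneq (p k) (p l); first by ring.
  by case: (p k) (p l) => [] [] //= _; ring.
rewrite pij => /(mulfI _); rewrite signr_eq0 => /(_ isT) z_cst.
by apply: (mulfI d_neq0); lra.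
Qed.

Variable a : R.
Hypothesis annihilA :
  (A *m A - (d ^+ 2)%:M) *m (A *m A - (a ^+ 2)%:M) = 0.

(** By [annihilA] the columns of [B] are [d ^+ 2]-eigenvectors of [A *m A], hence constant on each
    part. The diagonal fixes the constant in a vertex's own part; across parts [B] vanishes, since
    two steps return to the starting part. *)
Lemma adj_square : A *m A = (a ^+ 2)%:M + (d - a ^+ 2) *: K.
Proof.
set B := A *m A - (a ^+ 2)%:M.
have B_diag i : B i i = d - a ^+ 2.
  rewrite !mxE eqxx -(regA i); congr (_ - _); apply: eq_bigr => k _.
  by rewrite [A k i]symA idemA.
have B_cst i k j : p i = p k -> B i j = B k j.
  apply: (square_eigenvector_part_constant (x := fun i => B i j)) => l.
  have := annihilA; rewrite -/B mulmxBl mul_scalar_mx -mulmxA.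
  move=> /eqP; rewrite subr_eq0 => /eqP/matrixP/(_ l j).
  rewrite !mxE => <-; apply: eq_bigr => m _; congr (_ * _).
  by rewrite mxE.
apply/eqP; rewrite addrC -subr_eq; apply/eqP/matrixP => i j.
rewrite -/B [RHS]mxE [K i j]mxE; have [pij | npij] := eqVneq (p i) (p j).
  by rewrite (B_cst i j j pij) B_diag mulr1.
rewrite mulr0 !mxE big1.
  by rewrite (_ : i == j = false) ?subr0 //; apply: contraNF npij => /eqP ->.
move=> k _; have [/bipA -> | ] := eqVneq (p i) (p k); first by rewrite mul0r.
move=> npik; rewrite (bipA (i := k)) ?mulr0 //.
by case: (p i) (p j) (p k) npij npik => [] [] [].
Qed.

(** The row sums of [A *m A] are computed twice: by regularity and by [adj_square]. *)
Lemma part_card i :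
  (d - a ^+ 2) * (\sum_j (p i == p j)%:R) = d ^+ 2 - a ^+ 2.
Proof.
have : \sum_j (A *m A) i j = d ^+ 2.
  under eq_bigr do rewrite mxE.
  rewrite exchange_big /= expr2 -{1}(regA i) mulr_suml; apply: eq_bigr => k _.
  by rewrite -mulr_sumr regA.
rewrite adj_square => <-; under [in RHS]eq_bigr do rewrite !mxE.
rewrite big_split /= -mulr_sumr.
rewrite (_ : \sum_j a ^+ 2 *+ (i == j) = a ^+ 2); first by ring.
by rewrite (bigD1 i) //= eqxx big1 ?addr0 // => j; rewrite eq_sym => /negPf ->.
Qed.

Variable n : R.
Hypotheses (n_neq0 : n != 0) (a_neq0 : a != 0).
Hypothesis part_eq : (d - a ^+ 2) * n = d ^+ 2 - a ^+ 2.

(** The matrix [K + K'] is all ones and [K - K'] is its sign-twisted analogue. On the range of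
    [1%:M - n^-1 *: K] the square of [A] is [a ^+ 2], so the halves 1/2 (1 + A/a) and 1/2 (1 - A/a)
    separate the eigenvalues [a] and [- a]. *)
Lemma mxexp_heat t i j :
  mxexp (- t *: (d%:M - A)) i j = expR (- (d * t)) *
   ((p i == p j)%:R / n * coshR (d * t) + (p i != p j)%:R / n * sinhR (d * t)
    + ((i == j)%:R - (p i == p j)%:R / n) * coshR (a * t)
    + (A i j - d * (p i != p j)%:R / n) / a * sinhR (a * t)).
Proof.
have AA : A *m A = (a ^+ 2)%:M + ((d ^+ 2 - a ^+ 2) / n) *: K.
  by rewrite adj_square -part_eq mulfK.
pose l (i : 'I_4) := nth 0 [:: d; - d; a; - a] i.
(* the spectral projections of A for d, -d, a and -a *)
pose E (i : 'I_4) := nth (0 : 'M[R]_N) [::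
  (2 * n)^-1 *: (K + K'); (2 * n)^-1 *: (K - K');
  2^-1 *: ((1%:M - n^-1 *: K) + a^-1 *: (A - (d / n) *: K'));
  2^-1 *: ((1%:M - n^-1 *: K) - a^-1 *: (A - (d / n) *: K'))] i.
have AE k : A *m E k = l k *: E k.
  case: k => [[|[|[|[|//]]]]] kP; rewrite /E /l /= -scalemxAr ?mulmxDr ?mulmxBr
    ?mulmxN -?scalemxAr ?mulmxBr ?mulmx1 -?scalemxAr ?mul_adj_same ?mul_adj_cross ?AA;
  by apply/matrixP => r s; rewrite !mxE; field; rewrite ?a_neq0 ?n_neq0.
have sumE : \sum_k E k = 1%:M.
  rewrite !big_ord_recl big_ord0 /E /=.
  by apply/matrixP => r s; rewrite !mxE; field; rewrite ?a_neq0 ?n_neq0.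
rewrite (mxexp_eigen_decomposition (l := fun k => - (d * t) + l k * t) sumE); last first.
  move=> k; rewrite -scalemxAl mulmxBl mul_scalar_mx AE -scalerBl scalerA.
  by congr (_ *: _); ring.
rewrite !big_ord_recl big_ord0 /E /l /= !mxE !expRD /coshR /sinhR !mulNr.
by field; rewrite ?a_neq0 ?n_neq0.
Qed.

End RegularBipartite.

(** * Symmetric four-element spectra and harmonic functions *)

(** Once [d] and [- d] are removed, negation permutes the remaining two elements. It cannot fix
    both, as only 0 is fixed, so they are opposite and nonzero. *)
Lemma opp_closed_seq4 (R : realDomainType) (s : seq R) (d : R) :
  uniq s -> size s = 4%N -> {in s, forall x, - x \in s} -> d \in s -> d != 0 ->
  exists2 a, 0 < a & a ^+ 2 != d ^+ 2 /\ {subset s <= [:: d; - d; a; - a]}.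
Proof.
move=> us ss oppS ds d0.
have oppK0 (x : R) : (- x == x) = (x == 0) by apply/eqP/eqP; lra.
have nds : - d \in rem d s.
  by rewrite mem_rem_uniq // !inE oppK0 d0 oppS.
have s_perm : perm_eq s [:: d, - d & rem (- d) (rem d s)].
  by apply: (perm_trans (perm_to_rem ds)); rewrite perm_cons perm_to_rem.
move: (perm_size s_perm) (perm_mem s_perm) (perm_uniq s_perm).
rewrite ss us; case: (rem _ _) => [|x [|y [|? ?]]] //= _ mem_s.
move=> /esym; rewrite !inE !negb_or => /and4P [/and3P [_ dx dy] /andP [ndx ndy] xy _].
have x_s : - x \in s by apply: oppS; rewrite mem_s !inE eqxx !orbT.
have y_s : - y \in s by apply: oppS; rewrite mem_s !inE eqxx !orbT.
have yx : y = - x.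
  have oppd z : d != z -> - d != z -> - z \notin [:: d; - d].
    by move=> dz ndz; rewrite !inE eqr_oppLR eqr_opp ![z == _]eq_sym negb_or dz ndz.
  have {x_s} : - x \in [:: x; y].
    by move: x_s (oppd x dx ndx); rewrite mem_s !inE orbA => /orP [] ->.
  have {y_s} : - y \in [:: x; y].
    by move: y_s (oppd y dy ndy); rewrite mem_s !inE orbA => /orP [] ->.
  rewrite !inE => /orP [] /eqP ey /orP [] /eqP ex //; first by rewrite -ey opprK.
  by have /eqP [] := xy; lra.
have x0 : x != 0.
  by apply: contra xy => /eqP x0; rewrite yx x0 oppr0.
exists `|x|; first by rewrite normr_gt0.
split.
  rewrite real_normK ?num_real // eqf_sqr negb_or.
  by rewrite eq_sym dx eq_sym ndx.
move=> z; rewrite mem_s yx !inE.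
by case: (ger0P x) => _; rewrite ?opprK => /or4P [] ->; rewrite ?orbT.
Qed.

(** The Dirichlet energy of a [d]-eigenvector is zero, and its terms are nonnegative, so each of
    them vanishes. *)
Lemma harmonic_edge_constant (R : realDomainType) (N : nat) (A : 'M[R]_N)
    (d : R) (x : 'I_N -> R) :
  (forall i j, 0 <= A i j) -> (forall i j, A i j = A j i) ->
  (forall i, \sum_j A i j = d) ->
  (forall i, \sum_j A i j * x j = d * x i) ->
  forall i j, A i j != 0 -> x i = x j.
Proof.
move=> A0 symA regA harm.
have energy : \sum_i \sum_j A i j * (x i - x j) ^+ 2 = 0.
  have E i : \sum_j A i j * (x i - x j) ^+ 2 =
      - (d * x i ^+ 2) + \sum_j A i j * x j ^+ 2.
    rewrite (eq_bigr (fun j => A i j * x i ^+ 2 - 2 * x i * (A i j * x j)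
      + A i j * x j ^+ 2)); last by move=> j _; ring.
    rewrite big_split /= sumrB -mulr_suml -mulr_sumr regA harm; ring.
  under eq_bigr do rewrite E.
  rewrite big_split /= exchange_big /= -big_split big1 //= => i _.
  under eq_bigr do rewrite symA.
  by rewrite -mulr_suml regA addNr.
move=> i j Aij.
have sq0 k l : 0 <= A k l * (x k - x l) ^+ 2 by rewrite mulr_ge0 ?sqr_ge0.
have : \sum_l A i l * (x i - x l) ^+ 2 = 0.
  by apply: (psumr_eq0P _ energy) => // k _; apply: sumr_ge0.
move=> /psumr_eq0P /(_ j isT) /eqP; rewrite mulf_eq0 (negPf Aij) sqrf_eq0 subr_eq0.
by move=> h; apply/eqP/h.
Qed.

(** * Adjacency and Laplacian matrices of a regular graph *)

Section GraphMatrices.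
Variables (R : realType) (V : finType) (e : rel V) (d : nat).
Hypotheses (sym_e : symmetric e) (deg_e : forall v, degree e v = d).
Local Notation A := (adjacency R e).

Lemma adjacency_ge0 i j : 0 <= A i j.
Proof. by rewrite mxE. Qed.

Lemma adjacency_sym i j : A i j = A j i.
Proof. by rewrite !mxE sym_e. Qed.

Lemma adjacency_idem i j : A i j * A i j = A i j.
Proof. by rewrite mxE; case: (e _ _); rewrite ?mulr1 ?mulr0. Qed.

Lemma adjacency_row_sum i : \sum_j A i j = d%:R.
Proof.
rewrite -(deg_e (enum_val i)) /degree -sum1_card natr_sum [RHS]big_mkcond /=.
rewrite [RHS](reindex (@enum_val V predT)) /=; last exact: onW_bij (enum_val_bij V).
by apply: eq_bigr => j _; rewrite mxE inE; case: (e _ _).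
Qed.

Lemma laplacian_regular : laplacian R e = d%:R%:M - A.
Proof. by congr (_ - _); apply/matrixP => i j; rewrite !mxE deg_e. Qed.

Lemma eigenvalue_laplacian x :
  eigenvalue (laplacian R e) x = eigenvalue A (d%:R - x).
Proof.
apply/eigenvalueP/eigenvalueP => [] [v vE v0]; exists v => //; move: vE;
  rewrite laplacian_regular mulmxBr mul_mx_scalar scalerBl.
  by move=> <-; rewrite opprB addrC subrK.
by move=> ->; rewrite opprB addrC subrK.
Qed.

Hypothesis connected_e : connected_graph e.

Lemma adjacency_harmonic_constant (x : 'I_#|V| -> R) :
  (forall i, \sum_j A i j * x j = d%:R * x i) -> forall i j, x i = x j.
Proof.
move=> harm i j.
have edge := harmonic_edge_constant adjacency_ge0 adjacency_sym
  adjacency_row_sum harm.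
have path_cst q u : path e u q -> x (enum_rank u) = x (enum_rank (last u q)).
  elim: q u => [//|w q IH] u /= /andP [euw path_q].
  rewrite -(IH w path_q); apply: edge.
  by rewrite mxE !enum_rankK euw oner_eq0.
have /connectP [q /path_cst] := connected_e (enum_val i) (enum_val j).
by move=> xE jE; rewrite -jE !enum_valK in xE.
Qed.

Lemma degree_gt0 (u v : V) : u != v -> (0 < d)%N.
Proof.
move=> uv; have /connectP [[|w q] /=] := connected_e u v.
  by move=> _ /eqP; rewrite eq_sym (negPf uv).
move=> /andP [euw _] _; rewrite -(deg_e u) card_gt0.
by apply/set0Pn; exists w; rewrite inE.
Qed.

End GraphMatrices.

(** * Monotonic normalized heat diffusion *)

Theorem theorem1p2 (R : realType) (V : finType) (e : rel V)
  (simple_e : simple_graph e) (connected_e : connected_graph e)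
  (regular_e : regular_graph e) (bipartite_e : bipartite_graph e)
  (four_eigenvalues : (spectrum (laplacian R e) #= `I_4)%card) :
  MNHD R e.
Proof.
have [sym_e _] := simple_e; have [dn deg_e] := regular_e.
have [S bip_e] := bipartite_e.
move=> u v uv.
have d_ge1 : 1 <= dn%:R :> R by rewrite ler1n (degree_gt0 deg_e connected_e uv).
set d : R := dn%:R in d_ge1 *.
have d_neq0 : d != 0 by rewrite lt0r_neq0 // (lt_le_trans ltr01).
pose A := adjacency R e.
pose p (i : 'I_#|V|) := enum_val i \in S.
have symA : forall i j, A i j = A j i := adjacency_sym R sym_e.
have idemA : forall i j, A i j * A i j = A i j := adjacency_idem R e.
have regA : forall i, \sum_j A i j = d := adjacency_row_sum R deg_e.
have harmA := @adjacency_harmonic_constant R _ _ _ sym_e deg_e connected_e.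
have bipA i j : p i = p j -> A i j = 0.
  move=> pij; rewrite mxE; case E: (e _ _) => //.
  by move: (bip_e _ _ E); rewrite [_ \in S]pij eqxx.
have [a a_gt0 [a_d specA]] : exists2 a : R, 0 < a & a ^+ 2 != d ^+ 2 /\
    forall x, eigenvalue A x -> x \in [:: d; - d; a; - a].
  have fin : finite_set (spectrum (laplacian R e)) by exists 4%N.
  (* The reflection [d - l] carries the Laplacian spectrum to the adjacency spectrum. *)
  pose s := [seq d - l | l <- enum_fset (fset_set (spectrum (laplacian R e)))].
  have inj_subd : injective (fun l : R => d - l) by move=> y z /=; lra.
  have mem_s (x : R) : (x \in s) = eigenvalue A x.
    rewrite -[x in RHS](subKr d) -(eigenvalue_laplacian deg_e).
    have := mem_map inj_subd (enum_fset (fset_set (spectrum (laplacian R e)))) (d - x).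
    rewrite /= subKr => ->.
    transitivity (d - x \in fset_set (spectrum (laplacian R e))); first by [].
    by rewrite in_fset_set //; apply/idP/idP => [/set_mem|/mem_set].
  have [||x|||a a0 [ad sub]] := @opp_closed_seq4 _ s d.
  - by rewrite (map_inj_uniq inj_subd) fset_uniq.
  - by rewrite size_map; apply: card_fset_set four_eigenvalues.
  - by rewrite !mem_s; exact: (eigenvalue_opp bipA).
  - by rewrite mem_s (eigenvalue_degree symA regA) //; apply/card_gt0P; exists u.
  - exact: d_neq0.
  by exists a => //; split => // x; rewrite -mem_s; exact: sub.
have annihilA : (A *m A - (d ^+ 2)%:M) *m (A *m A - (a ^+ 2)%:M) = 0.
  have diff_sq x : (A - x%:M) *m (A - (- x)%:M) = A *m A - (x ^+ 2)%:M.
    rewrite raddfN opprK mulmxDr !mulmxBl -scalar_mxM scalar_mxC.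
    by rewrite addrA subrK.
  have trA : A^T = A by apply/matrixP => i j; rewrite mxE symA.
  have := symmetric_mx_annihilator trA specA.
  by rewrite !big_cons big_nil mulmx1 !mulmxA diff_sq -mulmxA diff_sq.
pose i : 'I_#|V| := enum_rank u; pose j : 'I_#|V| := enum_rank v.
have ij : i != j by rewrite (inj_eq enum_rank_inj).
have card_part := part_card symA bipA idemA regA harmA d_neq0 annihilA.
pose n : R := \sum_k (p i == p k)%:R.
have part_eq : (d - a ^+ 2) * n = d ^+ 2 - a ^+ 2 := card_part i.
(* Otherwise [part_eq] would force [a ^+ 2 = d ^+ 2]. Cancelling this factor in [card_part] shows
   that both parts have size [n]. *)
have coef_neq0 : d - a ^+ 2 != 0.
  apply: contraNneq a_d => c0; move: part_eq; rewrite c0 mul0r => /esym/eqP.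
  by rewrite subr_eq0 eq_sym.
have card_n k : \sum_l (p k == p l)%:R = n.
  by apply: (mulfI coef_neq0); rewrite card_part part_eq.
have design : (n - 1) * a ^+ 2 = d * (n - d) by move: part_eq; lra.
have n_ge1 : 1 <= n.
  by rewrite /n (bigD1 i) //= eqxx lerDl sumr_ge0.
(* Neighbours of [k] lie in the part of [m]; summing over [l] bounds the degree by the size of that
   part. *)
have le_part k l m : p k != p m -> A k l <= (p m == p l)%:R.
  have [/bipA -> // | kl] := eqVneq (p k) (p l).
  move=> km; rewrite (_ : p m == p l); first by rewrite mxE; case: (e _ _).
  by case: (p k) (p l) (p m) kl km => [] [] [].
have d_le_n : d <= n.
  have [m km] : exists m, p i != p m.
    apply/existsP; apply: contraNT d_neq0; rewrite negb_exists => /forallP np.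
    rewrite -(regA i) big1 // => m _; apply: bipA; apply/eqP.
    by have := np m; rewrite negbK.
  rewrite -(regA i) -(card_n m); apply: ler_sum => l _; exact: le_part.
have n_neq0 : n != 0 by rewrite lt0r_neq0 // (lt_le_trans ltr01).
have a_neq0 := lt0r_neq0 a_gt0.
have Aii : A i i = 0 by apply: bipA.
have heat t k : heat_kernel e t u (enum_val k) = expR (- (d * t)) *
   ((p i == p k)%:R / n * coshR (d * t) + (p i != p k)%:R / n * sinhR (d * t)
    + ((i == k)%:R - (p i == p k)%:R / n) * coshR (a * t)
    + (A i k - d * (p i != p k)%:R / n) / a * sinhR (a * t)).
  rewrite /heat_kernel enum_valK (laplacian_regular R deg_e).
  exact: (mxexp_heat symA bipA idemA regA harmA d_neq0 annihilA).
have den_neq0 t : (n - 1) * coshR (a * t) + coshR (d * t) != 0.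
  rewrite lt0r_neq0 // ltr_wpDl ?coshR_gt0 // mulr_ge0 ?subr_ge0 //.
  exact: ltW (coshR_gt0 _).
(* The factor exp(-dt) cancels; the [n] in front comes from clearing [1 / n] in the diagonal
   entry. *)
have ratio t : heat_ratio e u v t =
    n * ((p i == p j)%:R / n * coshR (d * t) + (p i != p j)%:R / n * sinhR (d * t)
    - (p i == p j)%:R / n * coshR (a * t)
    + (A i j - d * (p i != p j)%:R / n) / a * sinhR (a * t)) /
    ((n - 1) * coshR (a * t) + coshR (d * t)).
  have := heat t i; have := heat t j; rewrite !enum_rankK /heat_ratio => -> ->.
  have := expR_eq0 (- (d * t)) => /negbT x0.
  rewrite Aii !eqxx (negPf ij) /=; field.
  by rewrite ?x0 ?a_neq0 ?n_neq0 ?den_neq0.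
have mono (f : R -> R) : (forall t, heat_ratio e u v t = f t) ->
    {in `[0, +oo[ &, {homo f : s t / s <= t}} ->
    {in `[0, +oo[ &, {homo @heat_ratio R V e u v : s t / s <= t}}.
  by move=> ratioE mono_f s t s0 t0 st; rewrite !ratioE; exact: mono_f.
have [pij | npij] := eqVneq (p i) (p j).
  apply: (mono _ _ (same_part_ratio_nondecreasing a_gt0 n_ge1 d_ge1 _)) => [t|].
    rewrite ratio pij eqxx (bipA _ _ pij) /=; congr (_ / _); field.
    by rewrite ?a_neq0 ?n_neq0.
  have n_ge2 : 2 <= n.
    rewrite /n (bigD1 i) //= eqxx (bigD1 j) /=; last by rewrite eq_sym.
    by rewrite pij eqxx addrA -[2]/(1 + 1) lerDl sumr_ge0.
  (* For [a <= d], compare squares times [n - 1]: by [design] the difference is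
     [n * d * (d - 1)]. *)
  rewrite -(@ler_pXn2r _ 2) ?nnegrE ?(ltW a_gt0) ?(le_trans ler01 d_ge1) //.
  rewrite -(@ler_pM2l _ (n - 1)) ?design; last by lra.
  have : 0 <= n * d * (d - 1) by rewrite !mulr_ge0 // ?subr_ge0 //; lra.
  lra.
have [Aij0 | Aij] := eqVneq (A i j) 0.
  apply: (mono _ _ (nonadjacent_ratio_nondecreasing a_gt0 n_ge1 d_ge1 d_le_n design _)) => [t|].
    rewrite ratio (negPf npij) Aij0 /=; congr (_ / _); field.
    by rewrite ?a_neq0 ?n_neq0.
  (* The part of [v] contains all neighbours of [u] and also the non-neighbour [v], whence
     [d + 1 <= n]. *)
  rewrite -(regA i) -(card_n j) (bigD1 j) //= Aij0 add0r addrC.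
  rewrite [leRHS](bigD1 j) //= eqxx lerD2l.
  apply: ler_sum => l _; exact: le_part.
have Aij1 : A i j = 1 by apply: (mulfI Aij); rewrite idemA mulr1.
apply: (mono _ _ (adjacent_ratio_nondecreasing a_gt0 n_ge1 d_ge1 d_le_n design)) => t.
rewrite ratio (negPf npij) Aij1 /=; congr (_ / _); field.
by rewrite ?a_neq0 ?n_neq0.
Qed.
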